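(* Let $\Lambda$ be a ring with identity and $A,B,C\in\Lambda$. For every $n\ge0$, $\sum w(\alpha)x^{\alpha_0}$, the sum extending over all walks $\alpha$ of length $n$ (not necessarily standard) with finish $0$, equals the element $(Ax+B+Cx^{-1})^n$ of $\Lambda[x,x^{-1}]$.
   Context: A walk of length $l\ge0$ is an $(l+1)$-tuple $\alpha=(\alpha_0,\dots,\alpha_l)$ of integers with each $\alpha_i-\alpha_{i-1}\in\{-1,0,1\}$; its finish is $\alpha_l$. Its weight is $w(\alpha)=1$ if $l=0$, and otherwise $w(\alpha)=U_1\cdots U_l$ where $U_i=A,B,C$ according as $\alpha_i-\alpha_{i-1}=-1,0,1$. Here $x$ commutes with the elements of $\Lambda$. *)

(* Defs.v *)
From HB Require Import structures.
From mathcomp Require Import all_boot all_order all_algebra finmap.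
From mathcomp.multinomials Require Import monalg.

Set Implicit Arguments.
Unset Strict Implicit.
Unset Printing Implicit Defensive.

Import GRing.Theory.
Local Open Scope fset_scope.
Local Open Scope ring_scope.

(* The ring of Laurent polynomials over a possibly noncommutative ring R, the
   variable being central.  The additive group is that of finitely supported
   functions int -> R; [monalg] does not give the product, as its [monomType]
   excludes monoids with nontrivial units. *)
Definition laurent (R : pzRingType) : Type := {malg R[int]}.

HB.instance Definition _ (R : pzRingType) :=
  GRing.Zmodule.copy (laurent R) {malg R[int]}.

Section LaurentRing.
Variable R : pzRingType.
Implicit Types (f g h : laurent R) (c : R) (i j k : int).

Definition laurentM f g : laurent R :=
  \sum_(i <- msupp f) \sum_(j <- msupp g) << f@_i * g@_j *g i + j >>.

Definition laurentC c : laurent R := << c *g 0 >>.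

(* laurentXz k is the k-th power of the variable, for k of any sign. *)
Definition laurentXz k : laurent R := << 1 *g k >>.

Lemma laurentMw (d1 d2 : {fset int}) f g :
  msupp f `<=` d1 -> msupp g `<=` d2 ->
  laurentM f g = \sum_(i <- d1) \sum_(j <- d2) << f@_i * g@_j *g i + j >>.
Proof.
move=> le1 le2; rewrite /laurentM (big_fset_incl _ le1) /=.
  apply/eq_bigr=> i _; apply/big_fset_incl => // j _ /mcoeff_outdom ->.
  by rewrite mulr0 monalgU0.
move=> i _ /mcoeff_outdom fi.
by rewrite big1 // => j _; rewrite fi mul0r monalgU0.
Qed.

Lemma laurentM0g : left_zero 0 laurentM.
Proof. by move=> g; rewrite /laurentM msupp0 big_seq_fset0. Qed.

Lemma laurentMg0 : right_zero 0 laurentM.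
Proof.
by move=> f; rewrite /laurentM msupp0 big1 // => i _; rewrite big_seq_fset0.
Qed.

Lemma laurentMUg c k g :
  laurentM << c *g k >> g = \sum_(j <- msupp g) << c * g@_j *g k + j >>.
Proof.
rewrite (laurentMw msuppU_le (fsubset_refl _)) big_seq_fset1.
by apply/eq_bigr => j _; rewrite mcoeffUU.
Qed.

Lemma laurentMgU c k f :
  laurentM f << c *g k >> = \sum_(i <- msupp f) << f@_i * c *g i + k >>.
Proof.
rewrite (laurentMw (fsubset_refl _) msuppU_le).
by apply/eq_bigr => i _; rewrite big_seq_fset1 mcoeffUU.
Qed.

Lemma laurentMUU c1 c2 k1 k2 :
  laurentM << c1 *g k1 >> << c2 *g k2 >> = << c1 * c2 *g k1 + k2 >>.
Proof. by rewrite (laurentMw msuppU_le msuppU_le) !big_seq_fset1 !mcoeffUU. Qed.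

Lemma laurentM1g : left_id (laurentC 1) laurentM.
Proof.
move=> g; rewrite laurentMUg [RHS]monalgE.
by apply/eq_bigr=> j _; rewrite mul1r add0r.
Qed.

Lemma laurentMg1 : right_id (laurentC 1) laurentM.
Proof.
move=> f; rewrite laurentMgU [RHS]monalgE.
by apply/eq_bigr=> i _; rewrite mulr1 addr0.
Qed.

Lemma laurentMDl : left_distributive laurentM +%R.
Proof.
move=> f1 f2 g.
rewrite (laurentMw (msuppD_le f1 f2) (fsubset_refl _)).
rewrite [X in _ = X + _](laurentMw (fsubsetUl _ (msupp f2)) (fsubset_refl _)).
rewrite [X in _ = _ + X](laurentMw (fsubsetUr (msupp f1) _) (fsubset_refl _)).
rewrite -big_split /=; apply/eq_bigr=> i _.
rewrite -big_split /=; apply/eq_bigr=> j _.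
by rewrite mcoeffD mulrDl monalgUD.
Qed.

Lemma laurentMDr : right_distributive laurentM +%R.
Proof.
move=> f g1 g2.
rewrite (laurentMw (fsubset_refl _) (msuppD_le g1 g2)).
rewrite [X in _ = X + _](laurentMw (fsubset_refl _) (fsubsetUl _ (msupp g2))).
rewrite [X in _ = _ + X](laurentMw (fsubset_refl _) (fsubsetUr (msupp g1) _)).
rewrite -big_split /=; apply/eq_bigr=> i _.
rewrite -big_split /=; apply/eq_bigr=> j _.
by rewrite mcoeffD mulrDr monalgUD.
Qed.

Lemma laurentMA : associative laurentM.
Proof.
move=> f g h.
have suml u := big_morph (laurentM^~ u) (fun _ _ => laurentMDl _ _ _)
  (laurentM0g _).
have sumr u := big_morph (laurentM u) (fun _ _ => laurentMDr _ _ _)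
  (laurentMg0 _).
rewrite [f]monalgE [LHS]suml [laurentM _ g]suml [RHS]suml.
apply: eq_bigr=> i _.
rewrite [g]monalgE [laurentM _ h]suml [LHS]sumr [laurentM << _ *g i >> _]sumr.
rewrite [RHS]suml; apply: eq_bigr=> j _.
rewrite [h]monalgE [laurentM << _ *g j >> _]sumr [LHS]sumr [RHS]sumr.
by apply: eq_bigr=> k _; rewrite !laurentMUU mulrA addrA.
Qed.

HB.instance Definition _ := GRing.Zmodule_isPzRing.Build (laurent R)
  laurentMA laurentM1g laurentMg1 laurentMDl laurentMDr.

Lemma laurentC_is_zmod_morphism : zmod_morphism laurentC.
Proof. by move=> c1 c2; rewrite /laurentC monalgUB. Qed.

HB.instance Definition _ :=
  GRing.isZmodMorphism.Build R (laurent R) laurentC laurentC_is_zmod_morphism.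

Lemma laurentC_is_monoid_morphism : monoid_morphism laurentC.
Proof. by split=> // c1 c2; rewrite [RHS]laurentMUU addr0. Qed.

HB.instance Definition _ :=
  GRing.isMonoidMorphism.Build R (laurent R) laurentC
    laurentC_is_monoid_morphism.

Lemma laurentXz0 : laurentXz 0 = 1.
Proof. by []. Qed.

Lemma laurentXzD i j : laurentXz (i + j) = laurentXz i * laurentXz j.
Proof. by rewrite [RHS]laurentMUU mulr1. Qed.

Lemma laurentXz_comm k f : GRing.comm (laurentXz k) f.
Proof.
rewrite /GRing.comm [LHS]laurentMUg [RHS]laurentMgU.
by apply/eq_bigr => j _; rewrite mul1r mulr1 addrC.
Qed.

Lemma laurentE f : f = \sum_(k <- msupp f) laurentC f@_k * laurentXz k.
Proof.
rewrite [LHS]monalgE; apply/eq_bigr => k _.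
by rewrite [RHS]laurentMUU mulr1 add0r.
Qed.

End LaurentRing.

Definition is_walk (l : nat) (a : l.+1.-tuple int) : bool :=
  [forall i : 'I_l, a`_i.+1 - a`_i \in [:: -1; 0; 1]].

Definition start (l : nat) (a : l.+1.-tuple int) : int := tnth a ord0.

Definition finish (l : nat) (a : l.+1.-tuple int) : int := tnth a ord_max.

Section Weight.
Variables (R : pzRingType) (A B C : R).

(* Only the values at -1, 0 and 1 matter. *)
Definition step_weight (d : int) : R :=
  if d == -1 then A else if d == 0 then B else C.

(* The factors are in increasing order of i; the empty product is 1. *)
Definition weight (l : nat) (a : l.+1.-tuple int) : R :=
  \prod_(i < l) step_weight (a`_i.+1 - a`_i).

End Weight.

Record walk_to (l : nat) (b : int) := WalkTo {
  walk_tuple :> l.+1.-tuple int;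
  walk_toP : is_walk walk_tuple && (finish walk_tuple == b)
}.

HB.instance Definition _ l b := [isSub for @walk_tuple l b].
HB.instance Definition _ l b := [Countable of walk_to l b by <:].

(* A walk is recovered from its finish and its steps, so there are finitely
   many walks of given length and finish. *)
Section WalkFinite.
Variables (l : nat) (b : int).

Definition walk_steps (a : walk_to l b) :
    {ffun 'I_l -> seq_sub [:: -1; 0; 1 : int]} :=
  [ffun i => SeqSub (forallP (proj1 (andP (walk_toP a))) i)].

Definition walk_of_steps (s : {ffun 'I_l -> seq_sub [:: -1; 0; 1 : int]}) :
    option (walk_to l b) :=
  insub [tuple b - \sum_(j < l | (i <= j)%N) val (s j) | i < l.+1].

Lemma walk_stepsK : pcancel walk_steps walk_of_steps.
Proof.
move=> a; rewrite /walk_of_steps -[RHS]valK; congr insub.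
apply: eq_from_tnth => i; rewrite tnth_mktuple.
under eq_bigr do rewrite ffunE /=.
have leil : (i <= l)%N by rewrite -ltnS.
have /andP[_ /eqP] := walk_toP a; rewrite /finish (tnth_nth 0) /= => finish_a.
rewrite -(big_geq_mkord _ _ xpredT (fun j => a`_j.+1 - a`_j)) telescope_sumr //.
by rewrite (tnth_nth 0) finish_a subKr.
Qed.

HB.instance Definition _ : isFinite (walk_to l b) := PCanIsFinite walk_stepsK.

End WalkFinite.

(* Main.v *)
(** Expanding the n-th power of (A x + B + C x^-1) gives a sum over the words
    of n steps d_i in {-1, 0, 1}, the step d contributing (its weight) x^(-d).
    Words of n steps correspond bijectively to walks of length n with finish 0,
    and such a walk starts at minus the sum of its steps. *)

Require Import Defs.
From mathcomp Require Import all_boot all_algebra.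
Import GRing.Theory.
Local Open Scope ring_scope.

(** Lets the trinomial be written as a sum over a finite type, as distributing a product over
    functions requires. *)
Lemma sum_seq_sub (V : nmodType) (T : choiceType) (s : seq T) (F : T -> V) :
  uniq s -> \sum_(x : seq_sub s) F (val x) = \sum_(x <- s) F x.
Proof.
move=> Us; rewrite -[in RHS](val_seq_sub_enum Us) big_map.
by rewrite [index_enum _]unlock [in LHS]Finite.enum.unlock.
Qed.

Lemma comm_mulrACA (S : pzRingType) (a x b y : S) :
  GRing.comm x b -> a * x * (b * y) = a * b * (x * y).
Proof. by move=> xb; rewrite !mulrA -(mulrA a x b) xb !mulrA. Qed.

(** Powers of the variable are central, so they can be collected on the right while the
    coefficients, which need not commute, keep their order. *)
Lemma laurent_prod (R : pzRingType) (I : Type) (r : seq I) (w : I -> R)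
    (d : I -> int) :
  \prod_(i <- r) (laurentC (w i) * laurentXz R (d i)) =
  laurentC (\prod_(i <- r) w i) * laurentXz R (\sum_(i <- r) d i).
Proof.
elim: r => [|i r IHr]; first by rewrite !big_nil rmorph1 mul1r laurentXz0.
rewrite !big_cons IHr (rmorphM (@laurentC R)) laurentXzD.
exact/comm_mulrACA/laurentXz_comm.
Qed.

Section WalkSteps.
Variables (l : nat) (b : int).
Implicit Type s : {ffun 'I_l -> seq_sub [:: -1; 0; 1 : int]}.

Lemma start_walk_steps (a : walk_to l b) :
  start a = b - \sum_(i < l) val (walk_steps a i).
Proof.
have /andP[_ /eqP] := walk_toP a; rewrite /finish (tnth_nth 0) /= => finish_a.
under eq_bigr do rewrite ffunE /=.
rewrite -(big_mkord xpredT (fun j => a`_j.+1 - a`_j)) telescope_sumr //.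
by rewrite finish_a subKr /start (tnth_nth 0).
Qed.

(** Subtracting from [b] the steps still to come determines each entry. The sigma type lets the
    witness serve as an inverse function. *)
Lemma walk_steps_surj s : {a : walk_to l b | walk_steps a = s}.
Proof.
pose t := [tuple b - \sum_(j < l | (i <= j)%N) val (s j) | i < l.+1].
have tE i : (i <= l)%N -> t`_i = b - \sum_(j < l | (i <= j)%N) val (s j).
  by rewrite -ltnS => leil; rewrite -(tnth_nth 0 t (Ordinal leil)) tnth_mktuple.
have stepE (i : 'I_l) : t`_i.+1 - t`_i = val (s i).
  (* Splitting off [j = i] from the sum at index [i] leaves the sum at [i.+1], once [i < j] is put
     in the form [i <= j] and [j != i]. *)
  rewrite !tE ?(ltnW (ltn_ord i)) // [X in _ - (b - X)](bigD1 i) //=.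
  rewrite (eq_bigl (fun j : 'I_l => (i <= j)%N && (j != i))); last first.
    by move=> j; rewrite ltn_neqAle andbC eq_sym.
  by rewrite opprB [val _ + _]addrC !addrA subrK [b + _]addrC addrK.
have t_walk : is_walk t && (finish t == b).
  apply/andP; split; first by apply/forallP => i; rewrite stepE; apply: valP.
  (* No [j < l] satisfies [l <= j], so the last sum is empty. *)
  rewrite /finish (tnth_nth 0) tE // big_pred0 ?subr0 // => j.
  by rewrite leqNgt ltn_ord.
exists (WalkTo t_walk); apply/ffunP => i; rewrite ffunE.
exact/val_inj/stepE.
Qed.

Lemma walk_steps_bij : bijective (@walk_steps l b).
Proof.
have stepsK : cancel (fun s => sval (walk_steps_surj s)) (@walk_steps l b).
  by move=> s; case: (walk_steps_surj s).
(* Injectivity turns the right inverse into a two-sided one. *)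
by exists (fun s => sval (walk_steps_surj s)) => // a;
  apply: (pcan_inj (@walk_stepsK l b)).
Qed.

End WalkSteps.

Theorem theorem3p1 (R : pzRingType) (A B C : R) (n : nat) :
  \sum_(a : walk_to n 0) laurentC (weight A B C a) * laurentXz R (start a) =
  (laurentC A * laurentXz R 1 + laurentC B + laurentC C * laurentXz R (-1)) ^+ n
    :> laurent R.
Proof.
pose F (d : int) : laurent R :=
  laurentC (step_weight A B C d) * laurentXz R (- d).
have -> : laurentC A * laurentXz R 1 + laurentC B +
    laurentC C * laurentXz R (-1) = \sum_(d : seq_sub [:: -1; 0; 1 : int]) F (val d).
  rewrite sum_seq_sub // !big_cons big_nil addr0 addrA.
  by rewrite /F /step_weight /= opprK oppr0 laurentXz0 mulr1.
(* As a product of [n] equal sums, the power distributes into one ordered product per step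
   function. *)
rewrite -[in RHS](card_ord n) -prodr_const bigA_distr_bigA.
rewrite [RHS](reindex (@walk_steps n 0)) /=; last exact/onW_bij/walk_steps_bij.
apply: eq_bigr => a _; rewrite laurent_prod sumrN start_walk_steps sub0r.
by congr (laurentC _ * _); apply: eq_bigr => i _; rewrite ffunE.
Qed.
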